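(* Every guarded iterative monad on a category with finite coproducts, with $f^\dagger$ denoting the unique solution, satisfies naturality, dinaturality, codiagonal and uniformity.
   Context: $\mathbb T$ is a monad with unit $\eta$ and Kleisli lifting $(-)^*$. A guarded monad has a relation $f\colon X\to_\sigma TY$ ($\sigma$ a summand of $Y$, i.e. a pair of morphisms exhibiting $Y$ as a coproduct) closed under (trv) $T(\mathrm{inl})\circ f\colon X\to_{\mathrm{inr}}T(Y+Z)$ for all $f\colon X\to TY$; (par) $f\colon X\to_\sigma TZ$, $g\colon Y\to_\sigma TZ$ imply $[f,g]\colon X+Y\to_\sigma TZ$; (cmp) $f\colon X\to_{\mathrm{inr}}T(Y+Z)$, $g\colon Y\to_\sigma TV$, $h\colon Z\to TV$ imply $[g,h]^*\circ f\colon X\to_\sigma TV$. It is guarded iterative if every $f\colon X\to_{\mathrm{inr}}T(Y+X)$ has a unique $f^\dagger\colon X\to TY$ with $f^\dagger=[\eta,f^\dagger]^*\circ f$. Laws: naturality $g^*\circ f^\dagger=([T(\mathrm{inl})\circ g,\eta\circ\mathrm{inr}]^*\circ f)^\dagger$ for $f\colon X\to_{\mathrm{inr}}T(Y+X)$, $g\colon Y\to TZ$; dinaturality $([\eta\circ\mathrm{inl},h]^*\circ g)^\dagger=[\eta,([\eta\circ\mathrm{inl},g]^*\circ h)^\dagger]^*\circ g$ for $g\colon X\to T(Y+Z)$, $h\colon Z\to T(Y+X)$ with $g$ or $h$ $\mathrm{inr}$-guarded; codiagonal $(T[\mathrm{id},\mathrm{inr}]\circ f)^\dagger=(f^\dagger)^\dagger$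 for $f\colon X\to T((Y+X)+X)$ guarded in $[\mathrm{inl}\circ\mathrm{inr},\mathrm{inr}]$; uniformity: $f\circ h=T(\mathrm{id}+h)\circ g$ implies $f^\dagger\circ h=g^\dagger$ for $f\colon X\to_{\mathrm{inr}}T(Y+X)$, $g\colon Z\to_{\mathrm{inr}}T(Y+Z)$, $h\colon Z\to X$. *)

(* Defs.v *)
From Stdlib Require Import IndefiniteDescription.

Set Implicit Arguments.
Unset Strict Implicit.
Unset Printing Implicit Defensive.

Declare Scope cat_scope.
Delimit Scope cat_scope with cat.
Local Open Scope cat_scope.

Record category := Category {
  ob :> Type;
  hom : ob -> ob -> Type;
  idm : forall X, hom X X;
  comp : forall X Y Z, hom Y Z -> hom X Y -> hom X Z;
  comp_idl : forall X Y (f : hom X Y), comp (idm Y) f = f;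
  comp_idr : forall X Y (f : hom X Y), comp f (idm X) = f;
  comp_assoc : forall X Y Z W (h : hom Z W) (g : hom Y Z) (f : hom X Y),
    comp h (comp g f) = comp (comp h g) f
}.

Arguments hom {c} X Y.
Arguments idm {c} X.
Arguments comp {c X Y Z} g f.

Notation "X ~> Y" := (hom X Y) (at level 70, no associativity) : type_scope.
Notation "g \o f" := (comp g f) (at level 40, left associativity) : cat_scope.

Definition is_coproduct (C : category) (A B W : C) (i : A ~> W) (j : B ~> W) : Prop :=
  forall (Z : C) (f : A ~> Z) (g : B ~> Z),
    exists! h : W ~> Z, h \o i = f /\ h \o j = g.

Definition is_initial (C : category) (O : C) : Prop :=
  forall Z : C, exists! h : O ~> Z, True.

(* A summand of W is the injection [sumd_inj] together with its complement
   [sumd_cinj]; as in [inl, inr], the complement is the left-hand injection. *)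
Record summand (C : category) (W : C) := Summand {
  sumd_cob : C;
  sumd_ob : C;
  sumd_cinj : sumd_cob ~> W;
  sumd_inj : sumd_ob ~> W;
  sumd_coproduct : is_coproduct sumd_cinj sumd_inj
}.

Arguments sumd_coproduct {C W} s.

Definition copair (C : category) (W : C) (s : summand W) (Z : C)
    (f : sumd_cob s ~> Z) (g : sumd_ob s ~> Z) : W ~> Z :=
  proj1_sig (constructive_definite_description _ (sumd_coproduct s _ f g)).

Record fincoprod_category := FincoprodCategory {
  fc_cat :> category;
  zero : fc_cat;
  zero_initial : is_initial zero;
  sum : fc_cat -> fc_cat -> fc_cat;
  inl : forall A B, A ~> sum A B;
  inr : forall A B, B ~> sum A B;
  sum_coproduct : forall A B, is_coproduct (inl A B) (inr A B)
}.

Arguments sum {f} A B.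
Arguments inl {f A B}.
Arguments inr {f A B}.
Arguments sum_coproduct {f} A B.

Notation "A [+] B" := (sum A B) (at level 50, left associativity) : cat_scope.

Definition inr_summand (C : fincoprod_category) (A B : C) : summand (A [+] B) :=
  Summand (sum_coproduct A B).

Arguments inr_summand {C A B}.

Notation "[< f , g >]" := (copair (s := inr_summand) f g) : cat_scope.

Lemma copairP (C : category) (W : C) (s : summand W) (Z : C)
    (f : sumd_cob s ~> Z) (g : sumd_ob s ~> Z) :
  copair f g \o sumd_cinj s = f /\ copair f g \o sumd_inj s = g.
Proof.
exact (proj2_sig (constructive_definite_description _ (sumd_coproduct s _ f g))).
Qed.

Lemma copair_ext (C : category) (W : C) (s : summand W) (Z : C) (h k : W ~> Z) :
  h \o sumd_cinj s = k \o sumd_cinj s -> h \o sumd_inj s = k \o sumd_inj s -> h = k.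
Proof.
intros e1 e2.
destruct (sumd_coproduct s _ (k \o sumd_cinj s) (k \o sumd_inj s)) as [u [_ Hu]].
transitivity u; [symmetry|]; apply Hu; split; trivial.
Qed.

Lemma copair_inl (C : fincoprod_category) (A B Z : C) (f : A ~> Z) (g : B ~> Z) : [< f, g >] \o inl = f.
Proof. exact (proj1 (copairP (s := inr_summand) f g)). Qed.

Lemma copair_inr (C : fincoprod_category) (A B Z : C) (f : A ~> Z) (g : B ~> Z) : [< f, g >] \o inr = g.
Proof. exact (proj2 (copairP (s := inr_summand) f g)). Qed.

Lemma sum_ext (C : fincoprod_category) (A B Z : C) (h k : A [+] B ~> Z) :
  h \o inl = k \o inl -> h \o inr = k \o inr -> h = k.
Proof. exact (copair_ext (s := inr_summand) (h := h) (k := k)). Qed.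

Definition sum_map (C : fincoprod_category) (A B A' B' : C) (f : A ~> A') (g : B ~> B') :
    A [+] B ~> A' [+] B' :=
  [< inl \o f, inr \o g >].

Lemma right_two_coproduct (C : fincoprod_category) (A B D : C) :
  is_coproduct (W := (A [+] B) [+] D) (inl \o inl) [< inl \o inr, inr >].
Proof.
intros Z f g.
exists [< [< f, g \o inl >], g \o inr >]; split.
- split.
  + now rewrite comp_assoc, !copair_inl.
  + apply sum_ext; rewrite <- comp_assoc.
    * now rewrite copair_inl, comp_assoc, copair_inl, copair_inr.
    * now rewrite !copair_inr.
- intros h [e1 e2].
  apply sum_ext.
  + rewrite copair_inl; apply sum_ext.
    * now rewrite copair_inl, <- comp_assoc.
    * now rewrite copair_inr, <- e2, <- !comp_assoc, copair_inl.
  + now rewrite copair_inr, <- e2, <- comp_assoc, copair_inr.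
Qed.

(* The summand [inl \o inr, inr] : B + D of (A + B) + D, with complement inl \o inl. *)
Definition right_two_summand (C : fincoprod_category) (A B D : C) : summand ((A [+] B) [+] D) :=
  Summand (@right_two_coproduct C A B D).

Arguments right_two_summand {C A B D}.

Record monad (C : category) := Monad {
  T :> C -> C;
  eta : forall X, X ~> T X;
  lift : forall X Y, (X ~> T Y) -> (T X ~> T Y);
  lift_eta : forall X, lift (eta X) = idm (T X);
  lift_unit : forall X Y (f : X ~> T Y), lift f \o eta X = f;
  lift_comp : forall X Y Z (g : Y ~> T Z) (f : X ~> T Y),
    lift (lift g \o f) = lift g \o lift f
}.

Arguments eta {C} m {X}.
Arguments lift {C} m {X Y} f.

Definition Tmap (C : category) (M : monad C) (X Y : C) (f : X ~> Y) : M X ~> M Y :=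
  lift M (eta M \o f).

Arguments Tmap {C} M {X Y} f.

(* In [guarded_trv] and [guarded_cmp] the coproduct Y + Z is an arbitrary one:
   a summand [s] of an object W, whose injections [sumd_cinj s] and [sumd_inj s]
   play the roles of inl and inr. With the rules limited to the chosen coproducts
   [Y [+] Z], guardedness in a summand such as [right_two_summand] would be
   unrelated to guardedness in [inr_summand]. *)
Record guarded_monad (C : fincoprod_category) := GuardedMonad {
  gm_monad :> monad C;
  guarded : forall (X W : C), summand W -> (X ~> gm_monad W) -> Prop;
  guarded_trv : forall (X W : C) (s : summand W) (f : X ~> gm_monad (sumd_cob s)),
    guarded s (Tmap gm_monad (sumd_cinj s) \o f);
  guarded_par : forall (X Y Z : C) (s : summand Z)
      (f : X ~> gm_monad Z) (g : Y ~> gm_monad Z),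
    guarded s f -> guarded s g -> guarded s [< f, g >];
  guarded_cmp : forall (X W V : C) (s : summand W) (t : summand V)
      (f : X ~> gm_monad W)
      (g : sumd_cob s ~> gm_monad V) (h : sumd_ob s ~> gm_monad V),
    guarded s f -> guarded t g -> guarded t (lift gm_monad (copair g h) \o f)
}.

Arguments guarded {C} M {X W} s f : rename.

Definition solution (C : fincoprod_category) (M : guarded_monad C)
    (X Y : C) (f : X ~> M (Y [+] X)) (u : X ~> M Y) : Prop :=
  u = lift M [< eta M, u >] \o f.

Definition guarded_iterative (C : fincoprod_category) (M : guarded_monad C) : Prop :=
  forall (X Y : C) (f : X ~> M (Y [+] X)),
    guarded M inr_summand f -> exists! u : X ~> M Y, solution f u.

Definition dagger (C : fincoprod_category) (M : guarded_monad C)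
    (It : guarded_iterative M) (X Y : C) (f : X ~> M (Y [+] X))
    (Hf : guarded M inr_summand f) : X ~> M Y :=
  proj1_sig (constructive_definite_description _ (It X Y f Hf)).

(* [dagger] takes a proof of guardedness. Where the guardedness of an iterated
   morphism is not a hypothesis of the law, it is part of the conclusion, as an
   existential over such proofs. *)
Definition naturality (C : fincoprod_category) (M : guarded_monad C)
    (It : guarded_iterative M) : Prop :=
  forall (X Y Z : C) (f : X ~> M (Y [+] X)) (g : Y ~> M Z)
    (Hf : guarded M inr_summand f),
  exists Hg : guarded M inr_summand
                (lift M [< Tmap M inl \o g, eta M \o inr >] \o f),
    lift M g \o dagger It Hf = dagger It Hg.

Definition dinaturality (C : fincoprod_category) (M : guarded_monad C)
    (It : guarded_iterative M) : Prop :=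
  forall (X Y Z : C) (g : X ~> M (Y [+] Z)) (h : Z ~> M (Y [+] X)),
  guarded M inr_summand g \/ guarded M inr_summand h ->
  exists (Hgh : guarded M inr_summand (lift M [< eta M \o inl, h >] \o g))
         (Hhg : guarded M inr_summand (lift M [< eta M \o inl, g >] \o h)),
    dagger It Hgh = lift M [< eta M, dagger It Hhg >] \o g.

Definition codiagonal (C : fincoprod_category) (M : guarded_monad C)
    (It : guarded_iterative M) : Prop :=
  forall (X Y : C) (f : X ~> M ((Y [+] X) [+] X)),
  guarded M right_two_summand f ->
  exists (Hl : guarded M inr_summand (Tmap M [< idm (Y [+] X), inr >] \o f))
         (Hf : guarded M inr_summand f)
         (Hr : guarded M inr_summand (dagger It Hf)),
    dagger It Hl = dagger It Hr.

Definition uniformity (C : fincoprod_category) (M : guarded_monad C)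
    (It : guarded_iterative M) : Prop :=
  forall (X Y Z : C) (f : X ~> M (Y [+] X)) (g : Z ~> M (Y [+] Z)) (h : Z ~> X)
    (Hf : guarded M inr_summand f) (Hg : guarded M inr_summand g),
  f \o h = Tmap M (sum_map (idm Y) h) \o g ->
  dagger It Hf \o h = dagger It Hg.

(* Main.v *)
Require Import Defs.
From Stdlib Require Import IndefiniteDescription.

(** Each law equates a dagger with another morphism, so by uniqueness of
    solutions it suffices that the latter solves the same equation; this is a
    Kleisli computation from the fixpoint identities of the daggers involved.
    Guardedness of the iterated morphisms comes from (cmp), because
    [eta \o inl] is [inr]-guarded by (trv). When only the second of two
    composed morphisms is guarded, (cmp) is applied to the trivial coproduct
    W = W + 0, in which every morphism is guarded. *)

Set Implicit Arguments.
Unset Strict Implicit.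

Local Open Scope cat_scope.

Lemma copair_eq (C : category) (W : C) (s : summand W) (Z : C)
    (f : sumd_cob s ~> Z) (g : sumd_ob s ~> Z) (k : W ~> Z) :
  k \o sumd_cinj s = f -> k \o sumd_inj s = g -> copair f g = k.
Proof.
intros e1 e2; destruct (copairP f g) as [p1 p2].
now apply (copair_ext (s := s)); rewrite ?p1, ?p2.
Qed.

Lemma comp_copair (C : fincoprod_category) (A B Z Z' : C)
    (k : Z ~> Z') (f : A ~> Z) (g : B ~> Z) :
  k \o [< f, g >] = [< k \o f, k \o g >].
Proof.
now apply sum_ext; rewrite <- comp_assoc, ?copair_inl, ?copair_inr.
Qed.

Section Kleisli.

Variables (C : category) (M : monad C).

Lemma lift_lift (X Y Z W : C) (k : Z ~> M W) (g : Y ~> M Z) (f : X ~> M Y) :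
  lift M k \o (lift M g \o f) = lift M (lift M k \o g) \o f.
Proof. now rewrite lift_comp, comp_assoc. Qed.

Lemma lift_eta_comp (X Y Z : C) (k : Y ~> M Z) (g : X ~> Y) :
  lift M k \o (eta M \o g) = k \o g.
Proof. now rewrite comp_assoc, lift_unit. Qed.

Lemma lift_Tmap (X Y Z W : C) (k : Z ~> M W) (g : Y ~> Z) (f : X ~> M Y) :
  lift M k \o (Tmap M g \o f) = lift M (k \o g) \o f.
Proof. now unfold Tmap; rewrite lift_lift, lift_eta_comp. Qed.

End Kleisli.

Lemma trivial_coproduct (C : fincoprod_category) (W : C) (i : zero C ~> W) :
  is_coproduct (idm W) i.
Proof.
intros Z f g; exists f; split.
- split; [apply comp_idr|].
  destruct (zero_initial Z) as [u [_ Hu]].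
  now rewrite <- (Hu (f \o i) I), <- (Hu g I).
- now intros h [e _]; rewrite comp_idr in e.
Qed.

Section Guardedness.

Variables (C : fincoprod_category) (M : guarded_monad C).

Lemma guarded_eta_cinj (W : C) (s : summand W) : guarded M s (eta M \o sumd_cinj s).
Proof.
replace (eta M \o sumd_cinj s) with (Tmap M (sumd_cinj s) \o eta M).
- apply guarded_trv.
- apply lift_unit.
Qed.

(** This is (cmp) with [k] recovered as the copairing of its two restrictions, so only the one to
    the complement of [s] has to be guarded. *)
Lemma guarded_lift_guarded (X W V : C) (s : summand W) (t : summand V)
    (k : W ~> M V) (f : X ~> M W) :
  guarded M s f -> guarded M t (k \o sumd_cinj s) -> guarded M t (lift M k \o f).
Proof.
intros Hf Hk.
rewrite <- (copair_eq (s := s) (k := k) eq_refl eq_refl).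
now apply guarded_cmp.
Qed.

Lemma guarded_lift (X W V : C) (t : summand V) (k : W ~> M V) (f : X ~> M W) :
  guarded M t k -> guarded M t (lift M k \o f).
Proof.
intros Hk; destruct (zero_initial W) as [i _].
apply (guarded_lift_guarded (s := Summand (trivial_coproduct i))).
- replace f with (Tmap M (idm W) \o f).
  + exact (guarded_trv (s := Summand (trivial_coproduct i)) f).
  + now unfold Tmap; rewrite comp_idr, lift_eta, comp_idl.
- now simpl; rewrite comp_idr.
Qed.

Lemma guarded_copair_lift (X Y Z V : C) (t : summand V)
    (k : Y ~> M V) (h : Z ~> M V) (f : X ~> M (Y [+] Z)) :
  guarded M inr_summand f -> guarded M t k -> guarded M t (lift M [< k, h >] \o f).
Proof. intros Hf Hk; now apply guarded_cmp. Qed.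

Lemma guarded_eta_inl (X Y : C) : guarded M inr_summand (eta M \o @inl C X Y).
Proof. exact (guarded_eta_cinj inr_summand). Qed.

End Guardedness.

Section Laws.

Variables (C : fincoprod_category) (M : guarded_monad C) (It : guarded_iterative M).

Lemma dagger_solution (X Y : C) (f : X ~> M (Y [+] X))
    (Hf : guarded M inr_summand f) : solution f (dagger It Hf).
Proof. exact (proj2_sig (constructive_definite_description _ (It Hf))). Qed.

Lemma dagger_unique (X Y : C) (f : X ~> M (Y [+] X))
    (Hf : guarded M inr_summand f) (u : X ~> M Y) :
  solution f u -> dagger It Hf = u.
Proof.
intros Hu; destruct (It Hf) as [v [_ Hv]].
now rewrite <- (Hv _ Hu), <- (Hv _ (dagger_solution Hf)).
Qed.

Lemma guarded_iterative_naturality : naturality It.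
Proof.
intros X Y Z f g Hf.
assert (Hg : guarded M inr_summand
          (lift M [< Tmap M inl \o g, eta M \o inr >] \o f)).
{ apply guarded_copair_lift; [exact Hf|exact (guarded_trv (s := inr_summand) g)]. }
exists Hg; symmetry; apply dagger_unique; unfold solution.
(* Unfolding only the left-hand dagger brings both sides to [lift M
   [< g, lift M g \o dagger It Hf >] \o f]. *)
rewrite (dagger_solution Hf) at 1.
rewrite !lift_lift, !comp_copair, lift_Tmap, lift_eta_comp.
now rewrite copair_inl, copair_inr, lift_eta, comp_idl, lift_unit.
Qed.

Lemma guarded_iterative_dinaturality : dinaturality It.
Proof.
(* The hypothesis is symmetric in [g] and [h], so this one claim serves both iterated morphisms. *)
assert (G : forall (X Y Z : C) (g : X ~> M (Y [+] Z)) (h : Z ~> M (Y [+] X)),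
  guarded M inr_summand g \/ guarded M inr_summand h ->
  guarded M inr_summand (lift M [< eta M \o inl, h >] \o g)).
{ intros X Y Z g h [Hg|Hh].
  - apply guarded_copair_lift; [exact Hg|apply guarded_eta_inl].
  - apply guarded_lift, guarded_par; [apply guarded_eta_inl|exact Hh]. }
intros X Y Z g h H.
exists (G _ _ _ g h H), (G _ _ _ h g (proj1 (or_comm _ _) H)).
set (Hhg := G _ _ _ h g _); set (u := dagger It Hhg).
apply dagger_unique; unfold solution.
rewrite lift_lift, comp_copair, lift_eta_comp, copair_inl.
(* The two sides differ only in the second component of the copairing, and [e] is the fixpoint
   identity of [u] with its inner copairing multiplied out. *)
enough (e : u = lift M [< eta M, lift M [< eta M, u >] \o g >] \o h)
  by exact (f_equal (fun w => lift M [< eta M, w >] \o g) e).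
unfold u at 1; rewrite dagger_solution.
now rewrite lift_lift, comp_copair, lift_eta_comp, copair_inl.
Qed.

Lemma guarded_iterative_codiagonal : codiagonal It.
Proof.
intros X Y f H.
assert (Hl : guarded M inr_summand (Tmap M [< idm (Y [+] X), inr >] \o f)).
{ apply (guarded_lift_guarded H); simpl.
  rewrite <- comp_assoc, (comp_assoc _ inl), copair_inl, comp_idl.
  apply guarded_eta_inl. }
assert (Hf : guarded M inr_summand f).
{ rewrite <- (comp_idl f), <- lift_eta.
  apply (guarded_lift_guarded H); simpl.
  rewrite comp_assoc, <- lift_eta_comp.
  apply guarded_lift, guarded_eta_inl. }
assert (Hr : guarded M inr_summand (dagger It Hf)).
{ rewrite dagger_solution.
  apply (guarded_lift_guarded H); simpl.
  rewrite comp_assoc, copair_inl.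
  apply guarded_eta_inl. }
exists Hl, Hf, Hr; apply dagger_unique; unfold solution.
rewrite lift_Tmap, comp_copair, comp_idr, copair_inr.
generalize (dagger_solution Hr), (dagger_solution Hf); unfold solution.
generalize (dagger It Hr); generalize (dagger It Hf); clear.
intros v u eu ev.
(* In [eu], the inner solution [v] is unfolded once; after distributing, [lift M [< eta M, u >] \o
   v] folds back to [u]. *)
transitivity (lift M [< eta M, u >] \o (lift M [< eta M, v >] \o f)).
- now rewrite <- ev.
- rewrite lift_lift, comp_copair, lift_unit.
  exact (f_equal (fun w => lift M [< [< eta M, u >], w >] \o f) (eq_sym eu)).
Qed.

Lemma guarded_iterative_uniformity : uniformity It.
Proof.
intros X Y Z f g h Hf Hg e.
(* The candidate solution for [g] is [dagger It Hf \o h]: after one unfolding, [e] moves [h] past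
   [f] and into the copairing. *)
symmetry; apply dagger_unique; unfold solution.
rewrite (dagger_solution Hf) at 1.
unfold sum_map in e.
now rewrite <- comp_assoc, e, lift_Tmap, comp_copair, !comp_assoc,
  copair_inl, copair_inr, comp_idr.
Qed.

End Laws.

Theorem theorem5p2 (C : fincoprod_category) (M : guarded_monad C)
    (It : guarded_iterative M) :
  naturality It /\ dinaturality It /\ codiagonal It /\ uniformity It.
Proof.
split; [apply guarded_iterative_naturality|].
split; [apply guarded_iterative_dinaturality|].
split; [apply guarded_iterative_codiagonal|apply guarded_iterative_uniformity].
Qed.
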